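(* Let $k,n\in\mathbb{Z}_{>0}$, $m=(m_1,\dots,m_n)\in\mathbb{Z}_{>0}^n$, $|m|=m_1+\dots+m_n$. Let $p$ be a prime number with $p>|m|+1$ and $p>n+k$. Let $(t^0,z^0)=(t^0_1,\dots,t^0_k,z^0_1,\dots,z^0_n)\in\mathbb{F}_p^{k+n}$ have distinct coordinates. Denote $$y(x)=\prod_{i=1}^k(x-t^0_i),\qquad T(x)=\prod_{s=1}^n(x-z^0_s)^{m_s}\ \in\mathbb{F}_p[x].$$ Then the following two statements hold. (i) If $(t^0,z^0)$ is a solution of the Bethe ansatz equations $$\sum_{j\ne i}\frac{2}{t^0_i-t^0_j}-\sum_{s=1}^n\frac{m_s}{t^0_i-z^0_s}=0,\qquad i=1,\dots,k,$$ then $k\le|m|+1$, $2k\ne|m|+1$, and there exists a polynomial $\tilde y(x)\in\mathbb{F}_p[x]$ of degree $|m|+1-k$ such that $$\operatorname{Wr}(\tilde y(x),y(x))=T(x).$$ (ii) If there exists a polynomial $\tilde y(x)\in\mathbb{F}_p[x]$ satisfying $\operatorname{Wr}(\tilde y(x),y(x))=T(x)$, then $k\le|m|+1$, $2k\ne|m|+1$, and $(t^0,z^0)$ is a solution of the Bethe ansatz equations displayed in (i).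
   Context: For polynomials $g(x),h(x)$, the Wronskian is $\operatorname{Wr}(g(x),h(x))=g'(x)h(x)-g(x)h'(x)$, where $'$ denotes the formal derivative $d/dx$. *)

(* Defs.v *)
From mathcomp Require Import all_boot all_order all_algebra.

Set Implicit Arguments.
Unset Strict Implicit.
Unset Printing Implicit Defensive.

Import GRing.Theory.
Local Open Scope ring_scope.

(* The sign convention is Wr(g, h) = g' h - g h'. *)
Definition Wr (R : comNzRingType) (g h : {poly R}) : {poly R} :=
  g^`() * h - g * h^`().

Definition y_poly (R : comNzRingType) (k : nat) (t : k.-tuple R) : {poly R} :=
  \prod_(i < k) ('X - (tnth t i)%:P).

Definition T_poly (R : comNzRingType) (n : nat) (m : n.-tuple nat)
    (z : n.-tuple R) : {poly R} :=
  \prod_(s < n) ('X - (tnth z s)%:P) ^+ tnth m s.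

Definition weight (n : nat) (m : n.-tuple nat) : nat :=
  (\sum_(s < n) tnth m s)%N.

(* Inverses are total, with 0^-1 = 0: this has the intended meaning only when
   the coordinates of (t, z) are pairwise distinct. *)
Definition bethe_ansatz (F : fieldType) (k n : nat) (m : n.-tuple nat)
    (t : k.-tuple F) (z : n.-tuple F) : Prop :=
  forall i : 'I_k,
    \sum_(j < k | j != i) 2%:R / (tnth t i - tnth t j)
    - \sum_(s < n) (tnth m s)%:R / (tnth t i - tnth z s) = 0.

(* Main.v *)
(** Write [D y] for the condition [y %| T y'' - T' y'].  At a root [t_i] of [y]
    the [i]-th Bethe equation reads [y''/y' = T'/T], so the Bethe equations say
    exactly [D y].  If [T = Wr g y], then
    [T y'' - T' y' = y (g' y'' - g'' y')], which gives [D y].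
    Conversely, take [g0] of degree less than [deg y] with
    [g0 y' = - T] modulo [y]; then [D y] upgrades [Wr g0 y = T] from a congruence
    modulo [y] to one modulo [y ^ 2], say [T = Wr g0 y + q y^2].  As [p > |m| + 1],
    [q] has a primitive [S], and [Wr (g0 + S y) y = T].  The degree of this
    solution differs from [k] modulo [p], so it can be read off the leading
    coefficient of the Wronskian, and this forces the numerical conclusions. *)

Require Import Defs.
From mathcomp Require Import all_boot all_order all_algebra.
From mathcomp Require Import separable.
From mathcomp Require Import ring zify.

Set Implicit Arguments.
Unset Strict Implicit.
Unset Printing Implicit Defensive.

Import GRing.Theory.
Local Open Scope ring_scope.

(** Used to absorb an error term [q * y ^+ 2] by taking for [s] a primitive of [q]. *)
Lemma WrDM (R : comNzRingType) (g s y : {poly R}) :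
  Wr (g + s * y) y = Wr g y + s^`() * y ^+ 2.
Proof. by rewrite /Wr derivD derivM; ring. Qed.

Lemma dvdp_Wr (F : fieldType) (g y : {poly F}) :
  y %| Wr g y * y^`()^`() - (Wr g y)^`() * y^`().
Proof.
apply/dvdpP; exists (g^`() * y^`()^`() - g^`()^`() * y^`()).
by rewrite /Wr derivB !derivM; ring.
Qed.

(** The Euler operator [x d/dx] multiplies [x^j] by [j], so subtracting [deg g] times [g] cancels
    the leading term. *)
Lemma size_Euler (F : fieldType) (g : {poly F}) : g != 0 ->
  (size ('X * g^`() - (size g).-1%:R *: g)%R < size g)%N.
Proof.
move=> g0; have sg : (0 < size g)%N by rewrite size_poly_gt0.
rewrite -[X in (_ < X)%N](prednK sg) ltnS; apply/leq_sizeP => j le_j.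
rewrite coefB coefZ coefXM coef_deriv.
have [-> | nj] := eqVneq j (size g).-1.
  case: (size g).-1 => [|d] /=; first by rewrite mul0r subrr.
  by rewrite mulr_natl subrr.
rewrite (@nth_default _ _ g j); last by lia.
rewrite mulr0 subr0; case: j le_j nj => [//|j] le_j nj /=.
by rewrite nth_default ?mul0rn // -(prednK sg) ltn_neqAle eq_sym nj.
Qed.

Lemma size_polyM_lt (F : fieldType) (p q : {poly F}) (d : nat) :
  (0 < d)%N -> (size p + size q <= d)%N -> (size (p * q)%R < d)%N.
Proof. by move=> d0 le_d; apply: leq_ltn_trans (size_polyMleq p q) _; lia. Qed.

(** After multiplication by ['X], derivatives become Euler operators, and the top coefficient is
    [deg g - deg h] times the two leading coefficients. *)
Lemma size_Wr (F : fieldType) (g h : {poly F}) : g != 0 -> h != 0 ->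
  (size g)%:R != (size h)%:R :> F -> (size (Wr g h)).+2 = (size g + size h)%N.
Proof.
move=> g0 h0 ne_gh.
have sg : (0 < size g)%N by rewrite size_poly_gt0.
have sh : (0 < size h)%N by rewrite size_poly_gt0.
have a0 : (size g).-1%:R - (size h).-1%:R != 0 :> F.
  apply: contra ne_gh; rewrite subr_eq0 => /eqP e.
  by rewrite -(prednK sg) -(prednK sh) -!natr1 e.
have lt_g := size_Euler g0; have lt_h := size_Euler h0.
set eg := 'X * g^`() - _ in lt_g; set eh := 'X * h^`() - _ in lt_h.
(* [eg] and [eh] have smaller size than [g] and [h], so the size is that of the
   first summand. *)
have XW : 'X * Wr g h = ((size g).-1%:R - (size h).-1%:R) *: (g * h)
                        + (eg * h - g * eh).
  by rewrite /Wr /eg /eh -!mul_polyC rmorphB /=; ring.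
have s_gh : size (g * h) = (size g + size h).-1 by rewrite size_mul.
have szXW : size ('X * Wr g h) = (size g + size h).-1.
  rewrite XW size_polyDl size_scale // s_gh //.
  apply: (leq_ltn_trans (size_polyD _ _)); rewrite size_polyN gtn_max.
  by rewrite !size_polyM_lt //; lia.
have W0 : Wr g h != 0.
  by apply: contra_eq_neq szXW => ->; rewrite mulr0 size_poly0; lia.
by rewrite -size_mulX // mulrC szXW prednK // addn_gt0 sg.
Qed.

Lemma poly_primitive (F : fieldType) (q : {poly F}) :
  (forall i, (0 < i <= size q)%N -> i%:R != 0 :> F) ->
  exists2 r : {poly F}, (r * 'X)^`() = q & size r = size q.
Proof.
move=> nz; exists (\poly_(i < size q) (q`_i / i.+1%:R)).
  apply/polyP => i; rewrite coef_deriv coefMX coef_poly /=.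
  case: ltnP => [lt_i | le_i]; last by rewrite mul0rn nth_default.
  by rewrite -[LHS]mulr_natr divfK // nz.
have [-> | q0] := eqVneq q 0; first by rewrite size_poly0 poly_def big_ord0 size_poly0.
apply: size_poly_eq; rewrite mulf_neq0 ?invr_eq0 -?lead_coefE ?lead_coef_eq0 //.
by apply: nz; rewrite ltnS leq0n /= prednK ?size_poly_gt0.
Qed.

Lemma exists_Wr_mod_sqr (F : fieldType) (y T : {poly F}) :
    separable_poly y -> y %| T * y^`()^`() - T^`() * y^`() ->
  exists2 g : {poly F}, (size g < size y)%N & y ^+ 2 %| T - Wr g y.
Proof.
move=> sep_y /dvdpP[c eqc].
have y0 : y != 0 by apply: separable_poly_neq0.
have cop_y : coprimep y y^`() by move: sep_y; rewrite unlock.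
have /Bezout_eq1_coprimepP[[u v] /= uv1] := cop_y.
(* By [uv1], [v] inverts [y'] modulo [y], so [g y' = - T] modulo [y]. *)
pose g := (- (T * v)) %% y; exists g; first by rewrite ltn_modp.
have [r eqr] : exists r, g * y^`() + T = r * y.
  exists (u * T - ((- (T * v)) %/ y) * y^`()).
  have /(congr1 (fun f => f * y^`())) := divp_eq (- (T * v)) y.
  rewrite -/g => e; rewrite -[T in LHS]mulr1 -uv1; move/eqP: e.
  rewrite -subr_eq0 => /eqP e.
  by apply/eqP; rewrite -subr_eq0 -oppr_eq0 -e; apply/eqP; ring.
have eqT : T = r * y - g * y^`() by rewrite -eqr addrC addKr.
have eqT' : T^`() = r^`() * y + r * y^`() - (g^`() * y^`() + g * y^`()^`()).
  by rewrite eqT derivB !derivM.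
(* Substituting [T = r y - g y'] into [T y'' - T' y'] leaves [- y'^2 (r - g')] modulo [y].
   Cancelling [y'] twice gives [y %| r - g'], and [T - Wr g y = (r - g') y]. *)
have : y %| y^`() * (y^`() * (r - g^`())).
  apply/dvdpP; exists (r * y^`()^`() - r^`() * y^`() - c).
  rewrite mulrBl -eqc eqT' eqT; ring.
rewrite !Gauss_dvdpr // => /dvdpP[d eq_d].
apply/dvdpP; exists d.
rewrite eqT /Wr expr2 mulrA -eq_d; ring.
Qed.

Lemma exists_Wr (F : fieldType) (y T : {poly F}) :
    separable_poly y -> y %| T * y^`()^`() - T^`() * y^`() ->
    (forall i, (0 < i <= maxn (size T) (size y))%N -> i%:R != 0 :> F) ->
  exists2 g : {poly F}, Wr g y = T & (size g)%:R != (size y)%:R :> F.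
Proof.
move=> sep_y yT nz.
have y0 : y != 0 by apply: separable_poly_neq0.
have [g lt_g /dvdpP[q eq_q]] := exists_Wr_mod_sqr sep_y yT.
(* As [g] is smaller than [y], [Wr g y] cannot cancel the leading term of [q * y ^+ 2]; this bounds
   the integers to be inverted in the primitive of [q]. *)
have le_q : (size q <= size T)%N.
  have [-> | q0] := eqVneq q 0; first by rewrite size_poly0.
  have -> : T = q * y ^+ 2 + Wr g y by rewrite -eq_q subrK.
  have s2 : size (q * y ^+ 2) = (size q + (size y + size y).-1).-1.
    by rewrite size_mul ?expf_neq0 // expr2 size_mul.
  have sq : (0 < size q)%N by rewrite size_poly_gt0.
  have s1 : (size (Wr g y) < size (q * y ^+ 2)%R)%N.
    have -> : Wr g y = g^`() * y - g * y^`() by [].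
    apply: (leq_ltn_trans (size_polyD _ _)); rewrite size_polyN gtn_max s2.
    have lt_y' : (size y^`() < size y)%N by exact: lt_size_deriv.
    have le_g' : (size g^`() <= size g)%N.
      by apply: leq_trans (size_poly _ _) (leq_pred _).
    by rewrite !size_polyM_lt //; lia.
  by rewrite size_polyDl // s2; lia.
have [r Dr sr] : exists2 r : {poly F}, (r * 'X)^`() = q & size r = size q.
  by apply: poly_primitive => i i_q; apply: nz; lia.
exists (g + r * 'X * y); first by rewrite WrDM Dr -eq_q subrKC.
(* The sizes of the solution and of [y] differ by [size y - size g] if [r = 0], and by [size q]
   otherwise; both lie in the range where [nz] applies. *)
have [r0 | r0] := eqVneq r 0.
  rewrite r0 !mul0r addr0 eq_sym -subr_eq0 -natrB ?nz //; lia.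
have sry : size (r * 'X * y) = (size q + size y)%N.
  by rewrite size_mul ?mulf_neq0 ?polyX_eq0 // size_mulX // sr.
rewrite addrC size_polyDl sry; last by lia.
rewrite natrD -subr_eq0 addrK nz //.
by rewrite leq_max le_q -sr size_poly_gt0 r0.
Qed.

(** This is the logarithmic derivative of a product of powers, at a point that is not a root. *)
Lemma horner_deriv_prod_XsubC (F : fieldType) (I : finType) (P : pred I)
    (a : I -> F) (e : I -> nat) (x : F) : (forall i, P i -> x != a i) ->
  ((\prod_(i | P i) ('X - (a i)%:P) ^+ e i)^`()).[x] =
  (\prod_(i | P i) ('X - (a i)%:P) ^+ e i).[x] * \sum_(i | P i) (e i)%:R / (x - a i).
Proof.
move=> xa; pose K (f : {poly F}) s := f^`().[x] = f.[x] * s.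
apply: (big_rec2 K); first by rewrite /K derivC horner0 mulr0.
move=> i f s Pi; rewrite /K derivM !hornerE => ->.
rewrite deriv_exp derivXsubC mul1r.
have x0 : x - a i != 0 by rewrite subr_eq0 xa.
rewrite hornerMn !hornerE; case: (e i) => [|d] /=.
  by rewrite mulr0n !mul0r !add0r.
by rewrite exprS -mulr_natr; field.
Qed.

Lemma bethe_ansatzE (F : fieldType) (k n : nat) (m : n.-tuple nat)
    (t : k.-tuple F) (z : n.-tuple F) : uniq (t ++ z) ->
  bethe_ansatz m t z <->
  y_poly t %| T_poly m z * (y_poly t)^`()^`() - (T_poly m z)^`() * (y_poly t)^`().
Proof.
rewrite cat_uniq => /and3P[t_uniq /hasPn tz _].
have t_inj i j : j != i -> tnth t i != tnth t j.
  by move=> ne_ij; rewrite (tnth_nth 0) (tnth_nth 0) nth_uniq ?size_tuple // eq_sym.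
have neq_tz i s : tnth t i != tnth z s.
  by apply: contraTneq (mem_tnth s z) => <-; apply/negP => /tz; rewrite /= mem_tnth.
pose D := T_poly m z * (y_poly t)^`()^`() - (T_poly m z)^`() * (y_poly t)^`().
pose B i := \sum_(j < k | j != i) 2%:R / (tnth t i - tnth t j)
            - \sum_(s < n) (tnth m s)%:R / (tnth t i - tnth z s).
have eq_root i : (D.[tnth t i] == 0) = (B i == 0).
  (* At [t_i], [y' = Y] and [y'' = 2 Y'], so [D] takes the value [T Y B_i] there. The exponent 1
     fits the logarithmic derivative lemma. *)
  pose Y : {poly F} := \prod_(j < k | j != i) ('X - (tnth t j)%:P) ^+ 1.
  have yE : y_poly t = ('X - (tnth t i)%:P) * Y by rewrite /y_poly (bigD1 i).
  have d1 : (y_poly t)^`() = Y + ('X - (tnth t i)%:P) * Y^`().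
    by rewrite yE derivM derivXsubC mul1r.
  have d2 : (y_poly t)^`()^`() = Y^`() *+ 2 + ('X - (tnth t i)%:P) * Y^`()^`().
    by rewrite d1 derivD derivM derivXsubC mul1r addrA.
  have dY : Y^`().[tnth t i] =
      Y.[tnth t i] * \sum_(j < k | j != i) 1 / (tnth t i - tnth t j).
    by have := horner_deriv_prod_XsubC (fun=> 1%N) (t_inj i).
  have dT : (T_poly m z)^`().[tnth t i] = (T_poly m z).[tnth t i] *
      \sum_(s < n) (tnth m s)%:R / (tnth t i - tnth z s).
    by apply: (horner_deriv_prod_XsubC (P := xpredT)) => s _; apply: neq_tz.
  have Y0 : Y.[tnth t i] != 0.
    rewrite horner_prod; apply/prodf_neq0 => j ji.
    by rewrite !hornerE subr_eq0 t_inj.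
  have T0 : (T_poly m z).[tnth t i] != 0.
    rewrite horner_prod; apply/prodf_neq0 => s _.
    by rewrite !hornerE expf_neq0 // subr_eq0.
  have -> : D.[tnth t i] = (T_poly m z).[tnth t i] * Y.[tnth t i] * B i.
    rewrite /B /D d2 d1 !(hornerD, hornerN, hornerM, hornerMn, hornerX, hornerC) dY dT.
    have -> : \sum_(j < k | j != i) 2%:R / (tnth t i - tnth t j) =
        2%:R * \sum_(j < k | j != i) 1 / (tnth t i - tnth t j).
      by rewrite mulr_sumr; apply: eq_bigr => j _; rewrite mul1r.
    ring.
  by rewrite !mulf_eq0 (negPf T0) (negPf Y0).
have yE : y_poly t = \prod_(a <- t) ('X - a%:P) by rewrite big_tuple.
split=> [bae | y_dvd i].
  (* The [t_i] are distinct, so vanishing at each of them suffices for divisibility by [y]. *)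
  rewrite {1}yE; apply: uniq_roots_dvdp; last by rewrite uniq_rootsE.
  by apply/allP => _ /tnthP[i ->]; rewrite rootE eq_root /B bae.
apply/eqP; rewrite -/(B i) -eq_root -rootE; apply: root_dvdp y_dvd _.
by rewrite yE root_prod_XsubC mem_tnth.
Qed.

Theorem theorem3p2 (k n : nat) (k_gt0 : (0 < k)%N) (n_gt0 : (0 < n)%N)
    (m : n.-tuple nat) (m_gt0 : forall s : 'I_n, (0 < tnth m s)%N)
    (p : nat) (p_prime : prime p)
    (p_gt_m : (weight m + 1 < p)%N) (p_gt_nk : (n + k < p)%N)
    (t : k.-tuple 'F_p) (z : n.-tuple 'F_p) (tz_uniq : uniq (t ++ z)) :
  (bethe_ansatz m t z ->
     [/\ (k <= weight m + 1)%N, (2 * k)%N <> (weight m + 1)%N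
       & exists yt : {poly 'F_p},
           size yt = (weight m + 1 - k).+1 /\ Wr yt (y_poly t) = T_poly m z])
  /\
  ((exists yt : {poly 'F_p}, Wr yt (y_poly t) = T_poly m z) ->
     [/\ (k <= weight m + 1)%N, (2 * k)%N <> (weight m + 1)%N
       & bethe_ansatz m t z]).
Proof.
have natr_neq0 i : (0 < i < p)%N -> i%:R != 0 :> 'F_p.
  by move=> /andP[i0 ip]; rewrite -(dvdn_pcharf (pchar_Fp p_prime)) gtnNdvd.
have yE : y_poly t = \prod_(a <- t) ('X - a%:P) by rewrite big_tuple.
have size_y : size (y_poly t) = k.+1 by rewrite yE size_prod_XsubC size_tuple.
have size_T : size (T_poly m z) = (weight m).+1.
  rewrite size_prod => [|s _]; last by rewrite expf_neq0 // polyXsubC_eq0.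
  under eq_bigr do rewrite size_exp_XsubC -addn1.
  by rewrite big_split /= sum1_card -addSn addnK.
have sep_y : separable_poly (y_poly t).
  by rewrite yE separable_prod_XsubC; move: tz_uniq; rewrite cat_uniq => /andP[].
have solE : bethe_ansatz m t z <-> _ := bethe_ansatzE m tz_uniq.
have sol : bethe_ansatz m t z ->
     [/\ (k <= weight m + 1)%N, (2 * k)%N <> (weight m + 1)%N
       & exists yt : {poly 'F_p},
           size yt = (weight m + 1 - k).+1 /\ Wr yt (y_poly t) = T_poly m z].
  move=> /solE y_dvd.
  have [|g Wg ne_g] := exists_Wr sep_y y_dvd.
    (* Here [k + 1 <= n + k < p] by [n_gt0]. *)
    by move=> i; rewrite size_y size_T => i_le; apply: natr_neq0; lia.
  have g0 : g != 0.
    apply: contra_eq_neq Wg => ->.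
    by rewrite /Wr deriv0 !mul0r subrr eq_sym -size_poly_gt0 size_T.
  have y0 : y_poly t != 0 by rewrite -size_poly_gt0 size_y.
  have := size_Wr g0 y0 ne_g; rewrite Wg size_T size_y => sz.
  have sg : (0 < size g)%N by rewrite size_poly_gt0.
  have ne_sg : size g <> k.+1.
    by move=> e; move: ne_g; rewrite e size_y eqxx.
  (* By [sz], [deg g + k = |m| + 1], hence [k <= |m| + 1]; and [2k = |m| + 1] would force
     [deg g = k], against [ne_sg]. *)
  have size_g : size g = (weight m + 1 - k).+1 by lia.
  by split; [lia | lia | exists g].
split=> // -[g Wg].
(* The degree of this [g] is not determined, since adding [x^p y] preserves the Wronskian; the
   numerical conclusions come from the solution built in [sol]. *)
have bae : bethe_ansatz m t z by apply/solE; rewrite -Wg; apply: dvdp_Wr.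
by have [? ? _] := sol bae.
Qed.
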